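(* Let $n\ge 2$ and let $(L,[,\ldots,],\alpha)$ be a multiplicative $n$-ary Hom-Nambu algebra. For $k\ge 0$ define the $(2^k(n-1)+1)$-ary product $[,\ldots,]^{(k)}$ inductively by setting $[,\ldots,]^{(0)}=[,\ldots,]$ and, for $k\ge 1$ and $x_i\in L$, with $m=2^{k-1}(n-1)+1$ (so that $2m-1=2^k(n-1)+1$), $$[x_1,\ldots,x_{2m-1}]^{(k)}=[[x_1,\ldots,x_m]^{(k-1)},\alpha^{2^{k-1}}(x_{m+1}),\ldots,\alpha^{2^{k-1}}(x_{2m-1})]^{(k-1)}.$$ Then $L^k=(L,[,\ldots,]^{(k)},\alpha^{2^k})$ (with all twisting maps equal to $\alpha^{2^k}$) is a multiplicative $(2^k(n-1)+1)$-ary Hom-Nambu algebra for each $k\ge 0$.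
   Context: We work over a fixed field $\mathbf{k}$ of characteristic $0$. For a linear map $f\colon V\to V$, $f^r$ denotes the composition of $r$ copies of $f$. For an integer $n\ge 2$, an $n$-ary Hom-algebra $(V,[,\ldots,],\alpha=(\alpha_1,\ldots,\alpha_{n-1}))$ consists of a $\mathbf{k}$-module $V$, an $n$-linear map $[,\ldots,]\colon V^{\otimes n}\to V$, and linear maps $\alpha_i\colon V\to V$ ($1\le i\le n-1$), called twisting maps. It is multiplicative if $\alpha_1=\cdots=\alpha_{n-1}=\alpha$ and $\alpha\circ[,\ldots,]=[,\ldots,]\circ\alpha^{\otimes n}$. When all twisting maps are equal, $\alpha$ denotes their common value. An $n$-ary Hom-Nambu algebra is an $n$-ary Hom-algebra satisfying the $n$-ary Hom-Nambu identity $$[\alpha_1(x_1),\ldots,\alpha_{n-1}(x_{n-1}),[y_1,\ldots,y_n]]=\sum_{i=1}^n[\alpha_1(y_1),\ldots,\alpha_{i-1}(y_{i-1}),[x_1,\ldots,x_{n-1},y_i],\alpha_i(y_{i+1}),\ldots,\alpha_{n-1}(y_n)]$$ for all $x_1,\ldots,x_{n-1},y_1,\ldots,y_n\in V$. *)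

(* Defs.v *)
From mathcomp Require Import all_boot all_algebra.

Set Implicit Arguments.
Unset Strict Implicit.
Unset Printing Implicit Defensive.

Import GRing.Theory.
Local Open Scope ring_scope.

(* Indices are 0-based: the paper's x_1, ..., x_n are x 0, ..., x (n - 1), and
   the twisting maps alpha_1, ..., alpha_(n-1) are indexed by 'I_n.-1. *)

Definition multilinear (K : fieldType) (V : lmodType K) (n : nat)
    (br : {ffun 'I_n -> V} -> V) : Prop :=
  forall (i : 'I_n) (x : {ffun 'I_n -> V}),
    linear (fun v : V => br [ffun j => if j == i then v else x j]).

Definition hom_algebra (K : fieldType) (V : lmodType K) (n : nat)
    (br : {ffun 'I_n -> V} -> V) (alpha : 'I_n.-1 -> V -> V) : Prop :=
  multilinear br /\ forall i, linear (alpha i).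

Definition hom_multiplicative (K : fieldType) (V : lmodType K) (n : nat)
    (br : {ffun 'I_n -> V} -> V) (alpha : 'I_n.-1 -> V -> V) : Prop :=
  (forall i j, alpha i =1 alpha j) /\
  forall i (x : {ffun 'I_n -> V}),
    alpha i (br x) = br [ffun j => alpha i (x j)].

(* The n-tuple (x_1, ..., x_(n-1), z). *)
Definition snoc (V : Type) (n : nat) (x : {ffun 'I_n.-1 -> V}) (z : V) :
    {ffun 'I_n -> V} :=
  [ffun j : 'I_n => if insub (val j) : option 'I_n.-1 is Some j' then x j'
                    else z].

(* [unlift i j] is [None] if j = i; otherwise it is [Some j'] with j' = j if
   j < i and j' = j - 1 if i < j, so that y_j is twisted by alpha_j before
   position i and by alpha_(j-1) after it. *)
Definition hom_nambu_identity (K : fieldType) (V : lmodType K) (n : nat)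
    (br : {ffun 'I_n -> V} -> V) (alpha : 'I_n.-1 -> V -> V) : Prop :=
  forall (x : {ffun 'I_n.-1 -> V}) (y : {ffun 'I_n -> V}),
    br (snoc [ffun j => alpha j (x j)] (br y)) =
    \sum_(i < n) br [ffun j => if unlift i j is Some j' then alpha j' (y j)
                               else br (snoc x (y i))].

Definition hom_nambu_algebra (K : fieldType) (V : lmodType K) (n : nat)
    (br : {ffun 'I_n -> V} -> V) (alpha : 'I_n.-1 -> V -> V) : Prop :=
  hom_algebra br alpha /\ hom_nambu_identity br alpha.

Definition derived_arity (n k : nat) : nat := (2 ^ k * n.-1).+1.

(* Every [inord] below is applied to an index in range as soon as 0 < n: it only
   transports indices along derived_arity n 0 = n and
   derived_arity n k.+1 = 2 * derived_arity n k - 1.  In the successor case, with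
   m = derived_arity n k, position j >= 1 of the outer bracket holds the paper's
   x_(m+j), whose 0-based index is m + j - 1. *)
Fixpoint derived_bracket (V : Type) (n : nat) (br : {ffun 'I_n -> V} -> V)
    (alpha : V -> V) (k : nat) :
    {ffun 'I_(derived_arity n k) -> V} -> V :=
  match k return {ffun 'I_(derived_arity n k) -> V} -> V with
  | 0 => fun x => br [ffun j : 'I_n => x (inord j)]
  | k'.+1 => fun x =>
      let m := derived_arity n k' in
      let brk := @derived_bracket V n br alpha k' in
      brk [ffun j : 'I_m =>
             if j == ord0 then brk [ffun i : 'I_m => x (inord i)]
             else iter (2 ^ k') alpha (x (inord (m + j.-1)))]
  end.
Arguments derived_bracket {V n} br alpha k _.

(* Main.v *)
Require Import Defs.
From mathcomp Require Import all_boot all_algebra.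

Set Implicit Arguments.
Unset Strict Implicit.
Unset Printing Implicit Defensive.

Import GRing.Theory.
Local Open Scope ring_scope.

(** Let [b] be an m-ary bracket with twisting map [f], and
    b'(x_1, ..., x_(2m-1)) = b(b(x_1, ..., x_m), f x_(m+1), ..., f x_(2m-1)).
    With a = (b(x_1, ..., x_m), f x_(m+1), ..., f x_(2m-2)) one has
    b'(x, z) = b(a, f z), so the left-hand side of the identity for [b'] is
    f (b(f a, b(b(y_1, ..., y_m), f y_(m+1), ...))).  The identity for [b] makes
    it a sum of m terms; in the first of them f (b(a, b(y_1, ..., y_m)))
    = b(f a, b(f y_1, ..., f y_m)) is expanded by the identity once more, which
    gives the 2m - 1 terms of the right-hand side. *)

(* Arguments of a bracket of arity p + 1 are encoded as sequences [nat -> V] of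
   which only the terms 0, ..., p matter; this avoids casts between arities. *)
Record seq_hom_nambu (K : fieldType) (V : lmodType K) (p : nat)
    (b : (nat -> V) -> V) (f : V -> V) : Prop := SeqHomNambu {
  seq_ext : forall F G : nat -> V,
    (forall j, (j <= p)%N -> F j = G j) -> b F = b G;
  seq_multilinear : forall (i : nat) (F : nat -> V), (i <= p)%N ->
    linear (fun v : V => b (fun j => if j == i then v else F j));
  seq_twist_linear : linear f;
  seq_twist : forall F : nat -> V, f (b F) = b (fun j => f (F j));
  seq_nambu : forall X Y : nat -> V,
    b (fun j => if (j < p)%N then f (X j) else b Y) =
    \sum_(0 <= i < p.+1)
      b (fun j => if j == i then b (fun l => if (l < p)%N then X l else Y i)
                  else f (Y j))
}.

(** The bracket b' described above, with m = p + 1. The inner [b F] reads entries 0 to p, so outer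
    position j >= 1 receives entry p + j. *)
Definition seq_square (V : Type) (p : nat) (b : (nat -> V) -> V) (f : V -> V)
    (F : nat -> V) : V :=
  b (fun j => if j == 0%N then b F else f (F (p + j)%N)).

Fixpoint seq_derived (V : Type) (p : nat) (b : (nat -> V) -> V) (f : V -> V)
    (k : nat) : (nat -> V) -> V :=
  if k is k'.+1 then
    seq_square (2 ^ k' * p)%N (seq_derived p b f k') (iter (2 ^ k') f)
  else b.

Lemma linear_sum_nat (K : fieldType) (V W : lmodType K) (g : V -> W)
    (m n : nat) (F : nat -> V) : linear g ->
  g (\sum_(m <= i < n) F i) = \sum_(m <= i < n) g (F i).
Proof.
move=> g_lin.
have gD u v : g (u + v) = g u + g v by rewrite -[u in LHS]scale1r g_lin scale1r.
have g0 : g 0 = 0 by apply: (addrI (g 0)); rewrite -gD !addr0.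
exact: (big_morph g gD g0).
Qed.

Section Square.

Variables (K : fieldType) (V : lmodType K) (p : nat).
Variables (b : (nat -> V) -> V) (f : V -> V).
Hypotheses (p_gt0 : (0 < p)%N) (bP : seq_hom_nambu p b f).

Lemma seq_square_ext (F G : nat -> V) :
  (forall j, (j <= p + p)%N -> F j = G j) ->
  seq_square p b f F = seq_square p b f G.
Proof.
move=> eqFG; apply: (seq_ext bP) => j le_jp.
case: ifP => _; last by rewrite eqFG ?leq_add2l.
by apply: (seq_ext bP) => l le_lp; apply: eqFG; apply: leq_trans (leq_addr _ _).
Qed.

(** Together with [seq_square_high] this separates the positions: those up to p lie in the inner
    bracket, while p + i with 0 < i is outer position i and passes through [f]. *)
Lemma seq_square_low (i : nat) (F : nat -> V) (v : V) : (i <= p)%N ->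
  seq_square p b f (fun j => if j == i then v else F j) =
  b (fun j => if j == 0%N then b (fun l => if l == i then v else F l)
              else f (F (p + j)%N)).
Proof.
move=> le_ip; apply: (seq_ext bP) => -[|j] _ //=.
by rewrite gtn_eqF // (leq_ltn_trans le_ip) // addnS ltnS leq_addr.
Qed.

Lemma seq_square_high (i : nat) (F : nat -> V) (v : V) : (0 < i)%N ->
  seq_square p b f (fun j => if j == (p + i)%N then v else F j) =
  b (fun j => if j == i then f v
              else if j == 0%N then b F else f (F (p + j)%N)).
Proof.
move=> i_gt0; apply: (seq_ext bP) => j _.
rewrite eqn_add2l; have [->|_] := eqVneq j 0%N; last by case: (j == i).
rewrite eq_sym (gtn_eqF i_gt0).
apply: (seq_ext bP) => l le_lp.
by rewrite ltn_eqF // (leq_ltn_trans le_lp) // -addn1 leq_add2l.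
Qed.

Lemma seq_square_multilinear (i : nat) (F : nat -> V) : (i <= p + p)%N ->
  linear (fun v => seq_square p b f (fun j => if j == i then v else F j)).
Proof.
move=> le_ipp a u v /=; have [le_ip|lt_pi] := leqP i p.
  by rewrite !seq_square_low // (seq_multilinear bP _ le_ip)
    (seq_multilinear bP (fun j => f (F (p + j)%N)) (leq0n p)).
have le_dp : (i - p <= p)%N by rewrite leq_subLR.
have d_gt0 : (0 < i - p)%N by rewrite subn_gt0.
rewrite -(subnKC (ltnW lt_pi)) !seq_square_high // (seq_twist_linear bP).
exact: (seq_multilinear bP
  (fun j => if j == 0%N then b F else f (F (p + j)%N)) le_dp).
Qed.

Lemma seq_square_twist (F : nat -> V) :
  f (seq_square p b f F) = seq_square p b f (fun j => f (F j)).
Proof.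
rewrite /seq_square (seq_twist bP); apply: (seq_ext bP) => j _.
by case: ifP => // _; rewrite (seq_twist bP).
Qed.

(** Since p > 0, the last index p + p lies outside the inner bracket; it lands at outer position p
    and is twisted once. *)
Lemma seq_square_snoc (X : nat -> V) (z : V) :
  seq_square p b f (fun l => if (l < p + p)%N then X l else z) =
  b (fun l => if (l < p)%N then if l == 0%N then b X else f (X (p + l)%N)
              else f z).
Proof.
apply: (seq_ext bP) => -[|l] _ /=; last by rewrite ltn_add2l; case: ifP.
rewrite p_gt0; apply: (seq_ext bP) => l le_lp.
by rewrite (leq_ltn_trans le_lp) // -[X in (X < _)%N]addn0 ltn_add2l.
Qed.

Lemma seq_square_nambu (X Y : nat -> V) :
  seq_square p b f
    (fun j => if (j < p + p)%N then f (f (X j)) else seq_square p b f Y) =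
  \sum_(0 <= i < (p + p).+1)
    seq_square p b f (fun j =>
      if j == i
      then seq_square p b f (fun l => if (l < p + p)%N then X l else Y i)
      else f (f (Y j))).
Proof.
pose a l := if l == 0%N then b X else f (X (p + l)%N).
have snocE z : seq_square p b f (fun l => if (l < p + p)%N then X l else z) =
    b (fun l => if (l < p)%N then a l else f z) by exact: seq_square_snoc.
(* By multiplicativity every outer entry is an image under [f], so one [f] can be pulled out. *)
have -> : seq_square p b f
    (fun j => if (j < p + p)%N then f (f (X j)) else seq_square p b f Y) =
    f (b (fun j => if (j < p)%N then f (a j) else seq_square p b f Y)).
  rewrite seq_square_snoc (seq_twist bP); apply: (seq_ext bP) => j _.
  by rewrite /a; do 2!case: ifP => // _; rewrite !(seq_twist bP).
(* Unfolded, [seq_square p b f Y] is [b] of the tuple (b Y, f Y_(p+1), ..., f Y_(2p)), to which the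
   identity for [b] applies. The term i = 0 is split off; it accounts for the indices 0 to p on the
   right. *)
rewrite (seq_nambu bP) (linear_sum_nat _ _ _ (seq_twist_linear bP)) big_ltn //.
rewrite [RHS](@big_cat_nat _ _ _ p.+1) //=; last by rewrite ltnS leq_addr.
congr (_ + _).
  (* Pushing [f] inwards turns the entry at position 0 into a left-hand side of the identity for
     [b]; linearity in position 0 then distributes the resulting sum. *)
  have -> : f (b (fun j => if j == 0%N
        then b (fun l => if (l < p)%N then a l else b Y)
        else f (if j == 0%N then b Y else f (Y (p + j)%N)))) =
      b (fun j => if j == 0%N
        then b (fun l => if (l < p)%N then f (a l) else b (fun i => f (Y i)))
        else f (f (f (Y (p + j)%N)))).
    rewrite (seq_twist bP); apply: (seq_ext bP) => -[|j] _ //=.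
    rewrite (seq_twist bP); apply: (seq_ext bP) => l _.
    by case: ifP => // _; rewrite (seq_twist bP).
  rewrite (seq_nambu bP) (linear_sum_nat _ _ _
    (seq_multilinear bP (fun j => f (f (f (Y (p + j)%N)))) (leq0n p))).
  rewrite !big_mkord; apply: eq_bigr => i _.
  by rewrite (seq_square_low _ _ (leq_ord i)) snocE.
(* The remaining terms match one to one: outer position i >= 1 on the left is index p + i on the
   right. *)
rewrite [RHS](big_addn 1 _ p) subSn ?leq_addr //.
rewrite addnK; apply: eq_big_nat => i /andP[i_gt0 _].
rewrite (addnC i p) seq_square_high // snocE (seq_twist bP).
apply: (seq_ext bP) => j _; rewrite (gtn_eqF i_gt0).
case: ifP => // _; case: ifP => // _.
by rewrite !(seq_twist bP).
Qed.

Lemma seq_square_hom_nambu :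
  seq_hom_nambu (p + p)%N (seq_square p b f) (fun v => f (f v)).
Proof.
split.
- exact: seq_square_ext.
- exact: seq_square_multilinear.
- by move=> c u v /=; rewrite !(seq_twist_linear bP).
- by move=> F; rewrite !seq_square_twist.
- exact: seq_square_nambu.
Qed.

End Square.

(** Used to replace the doubled twist by [iter (2 ^ k.+1) f], which agrees with it pointwise;
    [seq_ext] carries the replacement under [b]. *)
Lemma eq_seq_hom_nambu (K : fieldType) (V : lmodType K) (p : nat)
    (b : (nat -> V) -> V) (f g : V -> V) :
  f =1 g -> seq_hom_nambu p b f -> seq_hom_nambu p b g.
Proof.
move=> eqfg [bE b_lin f_lin fb b_nambu]; split=> //.
- by move=> c u v; rewrite -!eqfg f_lin.
- by move=> F; rewrite -eqfg fb; apply: bE => j _.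
- move=> X Y; transitivity (b (fun j => if (j < p)%N then f (X j) else b Y)).
    by apply: bE => j _; rewrite eqfg.
  by rewrite b_nambu; apply: eq_bigr => i _; apply: bE => j _; rewrite eqfg.
Qed.

Lemma seq_derived_hom_nambu (K : fieldType) (V : lmodType K) (p : nat)
    (b : (nat -> V) -> V) (f : V -> V) (k : nat) :
  (0 < p)%N -> seq_hom_nambu p b f ->
  seq_hom_nambu (2 ^ k * p)%N (seq_derived p b f k) (iter (2 ^ k) f).
Proof.
move=> p_gt0 bP; elim: k => [|k IHk]; first by rewrite expn0 mul1n.
have q_gt0 : (0 < 2 ^ k * p)%N by rewrite muln_gt0 expn_gt0.
rewrite expnS mul2n -addnn mulnDl.
apply: eq_seq_hom_nambu (seq_square_hom_nambu q_gt0 IHk) => v.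
by rewrite iterD.
Qed.

Lemma seq_hom_nambu_of_ffun (K : fieldType) (V : lmodType K) (p : nat)
    (br : {ffun 'I_p.+1 -> V} -> V) (f : V -> V) : (0 < p)%N ->
  hom_nambu_algebra br (fun=> f) -> hom_multiplicative br (fun=> f) ->
  seq_hom_nambu p (fun F => br [ffun j : 'I_p.+1 => F j]) f.
Proof.
move=> p_gt0 [[br_lin f_lin] br_nambu] [_ br_mult].
split.
- by move=> F G eqFG; congr br; apply/ffunP=> j; rewrite !ffunE eqFG // -ltnS.
- move=> i F; rewrite -ltnS => lt_ip c u v.
  have := br_lin (Ordinal lt_ip) [ffun j : 'I_p.+1 => F j] c u v.
  by congr (br _ = _ *: br _ + br _); apply/ffunP=> j; rewrite !ffunE.
(* The twisting maps are indexed by ['I_p], which is inhabited because 0 < p. *)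
- exact: f_lin (Ordinal p_gt0).
- move=> F; rewrite (br_mult (Ordinal p_gt0)); congr br.
  by apply/ffunP=> j; rewrite !ffunE.
- move=> X Y.
  have := br_nambu [ffun j : 'I_p => X j] [ffun j : 'I_p.+1 => Y j].
  rewrite big_mkord; congr (_ = _).
    congr br; apply/ffunP=> j; rewrite !ffunE /=.
    case: insubP => [j' lt_jp eq_j|]; last by move/negbTE->.
    by rewrite !ffunE lt_jp -eq_j.
  apply: eq_bigr => i _; congr br; apply/ffunP=> j; rewrite !ffunE.
  case: unliftP => [j' ->|->].
    by have /negbTE := neq_lift i j'; rewrite eq_sym -val_eqE => ->.
  rewrite eqxx; congr br; apply/ffunP=> l; rewrite !ffunE /=.
  case: insubP => [l' lt_lp eq_l|]; last by move/negbTE->.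
  by rewrite !ffunE lt_lp -eq_l.
Qed.

Lemma ffun_of_seq_hom_nambu (K : fieldType) (V : lmodType K) (p : nat)
    (b : (nat -> V) -> V) (f : V -> V) (br : {ffun 'I_p.+1 -> V} -> V) :
  (forall x, br x = b (fun j => x (inord j))) -> seq_hom_nambu p b f ->
  hom_nambu_algebra br (fun=> f) /\ hom_multiplicative br (fun=> f).
Proof.
move=> brE [bE b_lin f_lin fb b_nambu].
have inord_eq (i : 'I_p.+1) j : (j <= p)%N -> (inord j == i) = (j == i).
  by move=> le_jp; rewrite -val_eqE /= inordK.
do 2!split=> //.
- split=> // i x c u v.
  have E w : br [ffun j => if j == i then w else x j] =
      b (fun j => if j == i then w else x (inord j)).
    by rewrite brE; apply: bE => j le_jp; rewrite ffunE inord_eq.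
  by rewrite !E b_lin // -ltnS.
- move=> x y.
  (* The default 0 is never read: [X] is only evaluated under the guard j < p. *)
  pose X j := if insub j is Some j' then x j' else 0.
  have snocE z : br (snoc x z) = b (fun j => if (j < p)%N then X j else z).
    rewrite brE; apply: bE => j le_jp; rewrite ffunE /= inordK // /X.
    by case: insubP => [j' ->|/negbTE->].
  have -> : br (snoc [ffun j => f (x j)] (br y)) =
      b (fun j => if (j < p)%N then f (X j) else b (fun j => y (inord j))).
    rewrite brE; apply: bE => j le_jp; rewrite ffunE /= inordK // /X -brE.
    by case: insubP => [j' -> _|/negbTE->] //; rewrite ffunE.
  rewrite b_nambu big_mkord; apply: eq_bigr => i _.
  rewrite brE; apply: bE => j le_jp; rewrite ffunE -inord_eq //.
  case: unliftP => [j' ->|->]; first by rewrite eq_sym (negbTE (neq_lift _ _)).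
  by rewrite eqxx snocE inord_val.
- move=> _ x; rewrite !brE fb; apply: bE => j _; by rewrite ffunE.
Qed.

(** Both recursions have the same shape; they are compared by [seq_ext] on indices within the arity,
    where [inord] preserves values. *)
Lemma derived_bracketE (K : fieldType) (V : lmodType K) (p : nat)
    (br : {ffun 'I_p.+1 -> V} -> V) (f : V -> V) (k : nat)
    (b := fun F : nat -> V => br [ffun j : 'I_p.+1 => F j]) :
  (0 < p)%N -> seq_hom_nambu p b f ->
  forall x, derived_bracket br f k x =
            seq_derived p b f k (fun j => x (inord j)).
Proof.
move=> p_gt0 bP; elim: k => [|k IHk] x //=.
have kP := seq_derived_hom_nambu k p_gt0 bP.
rewrite IHk; apply: (seq_ext kP) => j le_jp.
rewrite ffunE -val_eqE /= inordK //; case: eqP => [_|/eqP j_neq0].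
  by rewrite IHk; apply: (seq_ext kP) => l le_lp; rewrite ffunE inordK.
(* With q = 2 ^ k * p and j > 0, the index q.+1 + j.-1 equals q + j, the one in [seq_square]. *)
by rewrite addSn -addnS prednK // lt0n.
Qed.

Theorem corollary5p2 (K : fieldType) (charK0 : [pchar K] =i pred0)
    (L : lmodType K) (n : nat) (n_ge2 : (2 <= n)%N)
    (br : {ffun 'I_n -> L} -> L) (alpha : L -> L)
    (nambu : hom_nambu_algebra br (fun=> alpha))
    (mult : hom_multiplicative br (fun=> alpha)) (k : nat) :
  hom_nambu_algebra (derived_bracket br alpha k)
    (fun=> iter (2 ^ k) alpha) /\
  hom_multiplicative (derived_bracket br alpha k)
    (fun=> iter (2 ^ k) alpha).
Proof.
case: n n_ge2 br nambu mult => [//|p] p_gt0 br nambu mult.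
have bP := seq_hom_nambu_of_ffun p_gt0 nambu mult.
exact: ffun_of_seq_hom_nambu (derived_bracketE p_gt0 bP)
  (seq_derived_hom_nambu k p_gt0 bP).
Qed.
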